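(* Let $\tilde m_1$ be a piecewise polynomial function and $\tilde m_2$ a piecewise constant function on $[0,T]$ (with respect to the partition $(t_{i+j/p})$), and let $A$ be a constant. Then the function $$\tilde F(t)=A\int_0^t \tilde M(t)\,\tilde M^{-1}(s)\,\tilde m_1(s)\,\mathrm{d}s,\qquad \tilde M(t)=\exp\left(-\int_0^t\tilde m_2(s)\,\mathrm{d}s\right),\qquad t\in[0,T],$$ has a closed-form expression in the polynomial-exponential category, i.e. on each subinterval of the partition it coincides with an exponential polynomial.
   Context: Let $0=t_0<t_1<\dots<t_n<t_{n+1}=T$ and $p\in\mathbb{N}^*$. The finer partition $(t_{i+j/p})_{0\le i\le n,\,0\le j\le p-1}$ satisfies $t_i<t_{i+1/p}<\dots<t_{i+(p-1)/p}<t_{i+1}$ for each $i$. Piecewise polynomial (resp. constant) means that the function coincides with a polynomial (resp. a constant) on each subinterval $[t_{i+j/p},t_{i+(j+1)/p}]$ (up to values at endpoints). $\tilde M^{-1}(s)$ denotes $1/\tilde M(s)$. The polynomial-exponential category for (piecewise) smooth functions $[0,T]\to\mathbb{R}$ is the class generated by sums and products of polynomials and exponential mappings, i.e. (piecewise) finite sums $\sum_j P_j(t)e^{\lambda_j t}$ (exponential polynomials) with $P_j$ polynomials. *)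

(* Defs.v *)
From HB Require Import structures.
From mathcomp Require Import all_boot all_order all_algebra.
From mathcomp Require Import all_classical all_reals all_analysis.

Set Implicit Arguments.
Unset Strict Implicit.
Unset Printing Implicit Defensive.

Import Order.TTheory GRing.Theory Num.Theory.
Import numFieldNormedType.Exports.

Local Open Scope ring_scope.

(* 0 = t_0 < t_1 < ... < t_n < t_(n+1) = T; values of t beyond n.+1 are
   irrelevant. *)
Definition is_partition (R : realType) (T : R) (n : nat) (t : nat -> R) :=
  [/\ t 0%N = 0, t n.+1 = T & forall i, (i <= n)%N -> t i < t i.+1].

(* u i j stands for t_(i+j/p), for 0 <= i <= n and 0 <= j <= p; the index
   j = p repeats the next coarse node, so that the subintervals of the finer
   partition are exactly the [u i j, u i j.+1] with i <= n and j < p. *)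
Definition is_refinement (R : realType) (n p : nat) (t : nat -> R)
    (u : nat -> nat -> R) :=
  forall i, (i <= n)%N ->
    [/\ u i 0%N = t i, u i p = t i.+1 &
        forall j, (j < p)%N -> u i j < u i j.+1].

(* The subintervals are taken open: nothing is asked of the values of f at the
   nodes. *)
Definition piecewise_polynomial (R : realType) (n p : nat) (u : nat -> nat -> R)
    (f : R -> R) :=
  forall i j, (i <= n)%N -> (j < p)%N ->
    exists P : {poly R}, {in `]u i j, u i j.+1[, forall x, f x = P.[x]}.

Definition piecewise_constant (R : realType) (n p : nat) (u : nat -> nat -> R)
    (f : R -> R) :=
  forall i j, (i <= n)%N -> (j < p)%N ->
    exists c : R, {in `]u i j, u i j.+1[, forall x, f x = c}.

Definition exp_polynomial (R : realType) (f : R -> R) :=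
  exists s : seq ({poly R} * R),
    forall x, f x = \sum_(q <- s) q.1.[x] * expR (q.2 * x).

Definition Mtilde (R : realType) (m2 : R -> R) (t : R) : R :=
  expR (- \int[@lebesgue_measure R]_(s in `[0, t]) m2 s).

Definition Ftilde (R : realType) (A : R) (m1 m2 : R -> R) (t : R) : R :=
  A * \int[@lebesgue_measure R]_(s in `[0, t])
        (Mtilde m2 t * (Mtilde m2 s)^-1 * m1 s).

(* Main.v *)
Require Import Defs.
From HB Require Import structures.
From mathcomp Require Import all_boot all_order all_algebra.
From mathcomp Require Import all_classical all_reals all_analysis.
From mathcomp Require Import measurable_realfun ring.
Import Order.TTheory GRing.Theory Num.Theory.
Import numFieldNormedType.Exports.
Local Open Scope ring_scope.

(** On one subinterval [[a, b]] of the refinement, write [m2 = c] and [m1 = P]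
    in the interior. Integrating [m2] up to a point of [[a, b]] gives an affine
    function, so [Mtilde x = exp (- (k + c x))] there, and the factor
    [h = m1 / Mtilde] of the integrand is [exp k * P(s) * exp (c s)] in the
    interior: a single term polynomial times exponential, with the rate [c]
    opposite to that of [Mtilde]. Such a term has a primitive
    [Q(s) * exp (c s)] of the same shape ([poly_exp_primitive]), even for
    [c = 0], hence
      [F x = A exp (- k) exp (- c x) (K + Q(x) exp (c x))
           = A exp (- k) (K exp (- c x) + Q(x))]
    where the constant [K] collects everything that comes from the left of
    [a]. This is an exponential polynomial.

    The analytic part makes this legitimate for the Lebesgue integral of a
    function that is controlled only inside the subintervals. A function that
    agrees with continuous functions inside the subintervals is integrable up
    to every node ([refinement_integrable]); on each closed subinterval its
    indefinite integral is its value at the left node plus the increment of a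
    primitive of the continuous function ([Rintegral_extend]). Both lemmas serve
    twice, for [m2] and then for [h]. *)

Lemma poly_primitive (K : numFieldType) (P : {poly K}) :
  exists Q : {poly K}, Q^`() = P.
Proof.
exists (\poly_(i < (size P).+1) (P`_i.-1 / i%:R)).
apply/polyP => i; rewrite coef_deriv coef_poly ltnS /=.
case: ltnP => [_|Pi]; first by rewrite -[LHS]mulr_natr divfK// pnatr_eq0.
by rewrite mul0rn nth_default.
Qed.

(** Finding a primitive of [P * exp (c x)] in the form [Q * exp (c x)] amounts
    to solving [Q' + c Q = P]. For [c != 0], solving first for [P'] with
    solution [Q1], which has smaller degree, gives [Q = (P - Q1) / c]: this is
    integration by parts. *)
Lemma poly_exp_primitive (K : numFieldType) (c : K) (P : {poly K}) :
  exists Q : {poly K}, Q^`() + c *: Q = P.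
Proof.
have [->|c0] := eqVneq c 0.
  by have [Q <-] := poly_primitive K P; exists Q; rewrite scale0r addr0.
have [m] := ubnP (size P); elim: m P => // m IHm P sP.
have [->|P0] := eqVneq P 0.
  by exists 0; rewrite deriv0 scaler0 addr0.
have [Q dQ] : exists Q : {poly K}, Q^`() + c *: Q = P^`().
  by apply: IHm; rewrite (leq_trans (lt_size_deriv P0)).
exists (c^-1 *: (P - Q)).
rewrite derivZ derivB -dQ [Q^`() + _]addrC addrK !scalerA.
by rewrite mulVf// divff// !scale1r addrC subrK.
Qed.

Section piecewise_integral.
Context {R : realType}.
Notation mu := (@lebesgue_measure R).

Lemma is_derive_poly_exp (Q : {poly R}) (c x : R) :
  is_derive x 1 (fun y => Q.[y] * expR (c * y))
    ((Q^`() + c *: Q).[x] * expR (c * x)).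
Proof.
have h : is_derive x 1 (fun y : R => c * y) c.
  by apply: is_derive_eq; exact: mulr1.
have hexp : is_derive x 1 (fun y : R => expR (c * y)) (expR (c * x) * c).
  exact: (@is_derive1_comp _ expR).
apply: (@is_derive_eq _ _ _ _ _ _ _ _ (is_deriveM (is_derive_poly Q x) hexp)).
by rewrite hornerD hornerZ /GRing.scale/=; ring.
Qed.

Lemma continuous_poly_exp (Q : {poly R}) (c : R) :
  continuous (fun y => Q.[y] * expR (c * y)).
Proof.
move=> x; apply: differentiable_continuous; apply/derivable1_diffP.
by have [] := is_derive_poly_exp Q c x.
Qed.

Lemma integrableU d (T : measurableType d) (nu : {measure set T -> \bar R})
    (A B : set T) (f : T -> \bar R) :
  measurable A -> measurable B -> [disjoint A & B]%classic ->
  nu.-integrable A f -> nu.-integrable B f -> nu.-integrable (A `|` B)%classic f.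
Proof.
move=> mA mB AB /integrableP[mfA fA] /integrableP[mfB fB].
have mf := (measurable_funU _ mA mB).2 (conj mfA mfB).
apply/integrableP; split => //.
rewrite ge0_integral_setU//; last exact: measurableT_comp.
exact: lte_add_pinfty.
Qed.

Lemma integrable_subitv (f : R -> R) (i j : interval R) :
  ([set` i] `<=` [set` j])%classic ->
  mu.-integrable [set` j] (EFin \o f) -> mu.-integrable [set` i] (EFin \o f).
Proof.
move=> ij.
exact: (@integrableS _ _ _ mu _ _ _ (measurable_itv j) (measurable_itv i) ij).
Qed.

(** The nodes [a] and [b] are negligible, so that only the open interval
    matters; [g] is asked to be continuous up to the endpoints, since
    continuity of [f] inside would leave room for a blow-up there. *)
Lemma integrable_extend (f g : R -> R) (c a b : R) :
  c <= a -> a < b -> continuous g -> {in `]a, b[, f =1 g} ->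
  mu.-integrable `[c, a] (EFin \o f) -> mu.-integrable `[c, b] (EFin \o f).
Proof.
move=> ca ab cg fg fca.
have fab : mu.-integrable `]a, b[ (EFin \o f).
  apply: (@eq_integrable _ _ _ mu `]a, b[%classic (measurable_itv _) (EFin \o g)).
    by move=> x; rewrite inE/= => xab; rewrite fg.
  apply: (@integrable_subitv _ `]a, b[ `[a, b]).
    by apply: subset_itv; rewrite bnd_simp.
  apply: continuous_compact_integrable; first exact: segment_compact.
  exact: continuous_subspaceT.
have fb : mu.-integrable [set b] (EFin \o f).
  apply/integrableP; split; first exact: measurable_fun_set1.
  by rewrite integral_set1.
rewrite (@itv_bndbnd_setU _ _ _ (BRight a)) ?bnd_simp//; last exact: ltW.
rewrite (@itv_bndbnd_setU _ _ (BRight a) (BLeft b)) ?bnd_simp//.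
rewrite set_itv1.
apply: integrableU => //.
- by apply: measurableU.
- apply/disj_setPS => x /=; rewrite !in_itv/= => -[/andP[_ xa] [/andP[ax _]|xb]].
    by rewrite ltNge xa in ax.
  by rewrite xb leNgt ab in xa.
- apply: integrableU => //.
  by apply/disj_setPS => x /= [+ xb]; rewrite xb in_itv/= ltxx andbF.
Qed.

(** The fundamental theorem of calculus applied to the continuous [g] on
    [[a, x]], transferred to [f], which differs from [g] on [[a, x]] at most at
    the endpoints. *)
Lemma Rintegral_extend (f g G : R -> R) (c a b : R) :
  c <= a -> continuous g -> (forall x : R, is_derive x 1 G (g x)) ->
  {in `]a, b[, f =1 g} -> mu.-integrable `[c, b] (EFin \o f) ->
  {in `[a, b], forall x, \int[mu]_(s in `[c, x]) f s =
    \int[mu]_(s in `[c, a]) f s + (G x - G a)}.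
Proof.
move=> ca cg dG fg fcb x /[!in_itv]/= /andP[ax xb].
have fcx : mu.-integrable `[c, x] (EFin \o f).
  apply: integrable_subitv fcb.
  by apply: subset_itv; rewrite bnd_simp.
apply/eqP; rewrite addrC -subr_eq Rintegral_itvB ?bnd_simp//; apply/eqP.
have [xa|] := eqVneq a x.
  by rewrite xa set_itv_ge ?bnd_simp ?ltxx// Rintegral_set0 subrr.
rewrite neq_lt [x < a]ltNge ax orbF => {}ax.
have sub : (`]a, x[ `<=` `[c, x])%classic.
  by apply: subset_itv; rewrite bnd_simp.
rewrite -Rintegral_itv_bndo_bndc; last exact: integrable_subitv fcx.
have -> : \int[mu]_(s in `]a, x[) f s = \int[mu]_(s in `]a, x[) g s.
  apply: eq_Rintegral => y; rewrite inE/= in_itv/= => /andP[ay yx]; apply: fg.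
  by rewrite in_itv/= ay (lt_le_trans yx).
have gax : mu.-integrable `[a, x] (EFin \o g).
  apply: continuous_compact_integrable; first exact: segment_compact.
  exact: continuous_subspaceT.
have sub' (b1 b2 : bool) :
    ([set` Interval (BSide b1 a) (BSide b2 x)] `<=` `[a, x])%classic.
  by apply: subset_itv; case: b1; case: b2; rewrite bnd_simp.
rewrite Rintegral_itv_obnd_cbnd; last exact: integrable_subitv gax.
rewrite Rintegral_itv_bndo_bndc; last exact: integrable_subitv gax.
have dgG y : derivable G y 1 by have [] := dG y.
have cG : continuous G.
  by move=> y; apply: differentiable_continuous; apply/derivable1_diffP.
rewrite /Rintegral (@continuous_FTC2 _ _ G)//.
- exact: continuous_subspaceT.
- split; first by [].
  + exact/cvg_at_right_filter/cG.
  + exact/cvg_at_left_filter/cG.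
- by move=> y _; rewrite derive1E; have [_ ->] := dG y.
Qed.

(** Integrability propagates from node to node by [integrable_extend]. The
    conclusion includes [0 <= u i j] because the same induction provides it and
    the extension steps need it. *)
Lemma refinement_integrable (T : R) (n p : nat) (t : nat -> R)
    (u : nat -> nat -> R) (f : R -> R) :
  is_partition T n t -> is_refinement n p t u ->
  (forall i j, (i <= n)%N -> (j < p)%N ->
    exists2 g : R -> R, continuous g & {in `]u i j, u i j.+1[, f =1 g}) ->
  forall i j, (i <= n)%N -> (j <= p)%N ->
    0 <= u i j /\ mu.-integrable `[0, u i j] (EFin \o f).
Proof.
move=> [t0 _ _] hu hf.
have IHj i : (i <= n)%N ->
    0 <= t i /\ mu.-integrable `[0, t i] (EFin \o f) ->
    forall j, (j <= p)%N ->
    0 <= u i j /\ mu.-integrable `[0, u i j] (EFin \o f).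
  move=> iN hti; have [ui0 _ uS] := hu i iN.
  elim=> [_|j IHj jp]; first by rewrite ui0.
  have [u0 fu] := IHj (ltnW jp); have ujS := uS j jp.
  split; first by rewrite (le_trans u0)// ltW.
  have [g cg fg] := hf i j iN jp.
  exact: integrable_extend cg fg fu.
suff Ht i : (i <= n)%N -> 0 <= t i /\ mu.-integrable `[0, t i] (EFin \o f).
  by move=> i j iN; apply: IHj => //; exact: Ht.
elim: i => [_|i IHi iN].
  rewrite t0; split => //; rewrite set_itv1; apply/integrableP; split.
    exact: measurable_fun_set1.
  by rewrite integral_set1.
have [_ <- _] := hu i (ltnW iN).
by apply: IHj => //; [exact: ltnW|apply: IHi; exact: ltnW].
Qed.

End piecewise_integral.

Theorem proposition18 (R : realType) (T : R) (n p : nat)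
    (t : nat -> R) (u : nat -> nat -> R) (m1 m2 : R -> R) (A : R)
    (hp : (0 < p)%N)
    (ht : is_partition T n t)
    (hu : is_refinement n p t u)
    (hm1 : piecewise_polynomial n p u m1)
    (hm2 : piecewise_constant n p u m2) :
  forall i j, (i <= n)%N -> (j < p)%N ->
    exists g : R -> R, exp_polynomial g /\
      {in `[u i j, u i j.+1], forall x, Ftilde A m1 m2 x = g x}.
Proof.
have m2_int : forall i j, (i <= n)%N -> (j <= p)%N ->
    0 <= u i j /\ lebesgue_measure.-integrable `[0, u i j] (EFin \o m2).
  apply: (refinement_integrable _ _ _ _ _ _ ht hu) => i j iN jp.
  have [c m2c] := hm2 i j iN jp; exists (fun=> c) => //.
  by move=> x; exact: cvg_cst.
have M_exp i j : (i <= n)%N -> (j < p)%N -> exists c k : R,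
    {in `[u i j, u i j.+1], forall x, Mtilde m2 x = expR (- (k + c * x))}.
  move=> iN jp; have [c m2c] := hm2 i j iN jp.
  have [u0 _] := m2_int i j iN (ltnW jp).
  have [_ m2u] := m2_int i j.+1 iN jp.
  (* The affine function of slope c that takes the right value at the left node. *)
  exists c, (\int[lebesgue_measure]_(s in `[0, u i j]) m2 s - c * u i j) => x xu.
  rewrite /Mtilde (@Rintegral_extend _ m2 (fun=> c) ( *%R c)
    _ _ _ u0 _ _ m2c m2u)//.
  - by rewrite addrA addrAC.
  - by move=> y; exact: cvg_cst.
  - by move=> y; apply: is_derive_eq; exact: mulr1.
pose h s := (Mtilde m2 s)^-1 * m1 s.
have h_exp i j : (i <= n)%N -> (j < p)%N -> exists c k : R, exists P : {poly R},
    {in `[u i j, u i j.+1], forall x, Mtilde m2 x = expR (- (k + c * x))} /\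
    {in `]u i j, u i j.+1[, h =1 fun s => P.[s] * expR (c * s)}.
  move=> iN jp; have [c [k Mck]] := M_exp i j iN jp.
  have [P m1P] := hm1 i j iN jp.
  exists c, k, (expR k *: P); split=> // x xu.
  rewrite /h m1P// Mck; last exact: subset_itv_oo_cc.
  by rewrite expRN invrK expRD hornerZ; ring.
have h_int : forall i j, (i <= n)%N -> (j <= p)%N ->
    0 <= u i j /\ lebesgue_measure.-integrable `[0, u i j] (EFin \o h).
  apply: (refinement_integrable _ _ _ _ _ _ ht hu) => i j iN jp.
  have [c [k [P [_ hP]]]] := h_exp i j iN jp.
  by exists (fun s => P.[s] * expR (c * s)) => //; exact: continuous_poly_exp.
move=> i j iN jp.
have [c [k [P [Mck hP]]]] := h_exp i j iN jp.
have [Q QP] := poly_exp_primitive R c P.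
have [u0 _] := h_int i j iN (ltnW jp).
have [_ hu1] := h_int i j.+1 iN jp.
pose G y := Q.[y] * expR (c * y).
pose K := \int[lebesgue_measure]_(s in `[0, u i j]) h s - G (u i j).
exists (fun x => (A * expR (- k)) * (K * expR (- c * x) + Q.[x])); split.
  exists [:: ((A * expR (- k) * K)%:P, - c); ((A * expR (- k)) *: Q, 0)] => x.
  rewrite !big_cons big_nil addr0/= hornerC hornerZ mul0r expR0 mulr1.
  by rewrite mulrDr mulrA.
move=> x xu.
have hx : lebesgue_measure.-integrable `[0, x] (EFin \o h).
  apply: integrable_subitv hu1; apply: subset_itvl.
  by move: xu; rewrite in_itv/= bnd_simp => /andP[].
(* Mtilde m2 x does not depend on the integration variable. *)
rewrite /Ftilde; under eq_Rintegral do rewrite -mulrA.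
rewrite RintegralZl//.
rewrite (@Rintegral_extend _ h _ G _ _ _ u0 _ _ hP hu1)//.
- rewrite Mck// opprD expRD mulNr !expRN /K /G; field.
  by rewrite !gt_eqF ?expR_gt0.
- exact: continuous_poly_exp.
- by move=> y; rewrite -QP; exact: is_derive_poly_exp.
Qed.
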